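(* Let $\mu$ be a probability measure supported on a symmetric convex domain $\Omega\subset\mathbb R^n$ with $\int_\Omega|x|\,d\mu(x)<+\infty$. Suppose that for some $\kappa>0$, $$\mathrm{Ent}_\mu(f)\le\frac1\kappa\int_\Omega\Phi_f\,d\mu\quad\text{for all }f\in\mathrm{QC}^1(\Omega,\mu).$$ Then $\mu$ satisfies the dilation inequality for $\mathcal K_s^n(\Omega)$ with constant $\kappa$.
   Context: Symmetric set: $K=-K$; symmetric function: $f(x)=f(-x)$; quasi-convex: $\{f<\lambda\}$ convex for all $\lambda$. Symmetric convex domain: nonempty open convex $\Omega=-\Omega\subset\mathbb R^n$. $\mathcal K_s^n(\Omega)$: nonempty symmetric open convex subsets of $\Omega$. For Borel $A$, $\varepsilon\in(0,1)$: $A_\varepsilon:=A\cup\{x:\exists y,\ \int_0^1\mathbf 1_A((1-t)x+ty)\,dt>1-\varepsilon\}$; $\mu^*(A):=\liminf_{\varepsilon\downarrow0}(\mu(A_\varepsilon)-\mu(A))/\varepsilon$. Dilation inequality with $\kappa$: $\mu^*(K)\ge-\kappa(1-\mu(K))\log(1-\mu(K))$ for all $K\in\mathcal K_s^n(\Omega)$. $\mathrm{Ent}_\mu(f):=\int f\log f\,d\mu-\int f\,d\mu\log\int f\,d\mu$. $\Phi_f(x):=\limsup_{\varepsilon\downarrow0}\frac{f(x)-f(\frac{1-\varepsilon}{1+\varepsilon}x)}{\varepsilon}$. $\mathrm{QC}(\Omega,\mu)$: all nonnegative, continuous, symmetric quasi-convex $f$ on $\Omega$ for which there exist a nonnegative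 Borel $g\in L^1(\mu)$ and $\varepsilon_0\in(0,1]$ with $\sup_{\varepsilon\in(0,\varepsilon_0)}\frac{f(x)-f(\frac{1-\varepsilon}{1+\varepsilon}x)}{\varepsilon}\le g(x)$ for all $x\in\Omega$. $\mathrm{QC}^p(\Omega,\mu):=\{f:f^p\in\mathrm{QC}(\Omega,\mu)\cap L^1(\mu)\}$. *)

(* Defs.v *)
From HB Require Import structures.
From mathcomp Require Import all_boot all_order all_algebra.
From mathcomp Require Import all_classical all_reals all_analysis.

Set Implicit Arguments.
Unset Strict Implicit.
Unset Printing Implicit Defensive.
Import Order.TTheory GRing.Theory Num.Theory.
Import numFieldNormedType.Exports.
Local Open Scope classical_set_scope.
Local Open Scope ring_scope.

Definition borelRn (R : realType) (n : nat) :=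
  g_sigma_algebraType (@open 'rV[R]_n).

Definition eucl_norm (R : realType) (n : nat) (x : 'rV[R]_n) : R :=
  Num.sqrt (\sum_(i < n) x ord0 i ^+ 2).

Definition convex_rV (R : realType) (n : nat) (A : set 'rV[R]_n) : Prop :=
  forall x y (t : R), A x -> A y -> 0 <= t <= 1 -> A ((1 - t) *: x + t *: y).

Definition symmetric_set (R : realType) (n : nat) (A : set 'rV[R]_n) : Prop :=
  forall x, A x -> A (- x).

Definition sym_convex_domain (R : realType) (n : nat) (O : set 'rV[R]_n) : Prop :=
  O !=set0 /\ open O /\ convex_rV O /\ symmetric_set O.

Definition Ks (R : realType) (n : nat) (O K : set 'rV[R]_n) : Prop :=
  K !=set0 /\ symmetric_set K /\ open K /\ convex_rV K /\ K `<=` O.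

Definition dil_set (R : realType) (n : nat) (A : set 'rV[R]_n) (e : R)
  : set 'rV[R]_n :=
  A `|` [set x | exists y : 'rV[R]_n,
     ((1 - e)%:E < \int[@lebesgue_measure R]_(t in `[0%R, 1%R])
                      (\1_A ((1 - t) *: x + t *: y) : R)%:E)%E].

Definition mu_star (R : realType) (n : nat) (mu : probability (borelRn R n) R)
  (A : set 'rV[R]_n) : \bar R :=
  limf_einf (fun e : R => ((mu (dil_set A e) - mu A) * (e^-1)%:E)%E) (0 : R)^'+.

Definition dilation_ineq (R : realType) (n : nat) (O : set 'rV[R]_n)
  (mu : probability (borelRn R n) R) (kappa : R) : Prop :=
  forall K, Ks O K ->
    ((- kappa * (1 - fine (mu K)) * ln (1 - fine (mu K)))%:E <= mu_star mu K)%E.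

(* Ent_mu(f) (integrals over Omega, on which mu is supported) *)
Definition Ent (R : realType) (n : nat) (O : set 'rV[R]_n)
  (mu : probability (borelRn R n) R) (f : 'rV[R]_n -> R) : \bar R :=
  let I := fine (\int[mu]_(x in O) (f x)%:E)%E in
  (\int[mu]_(x in O) (f x * ln (f x))%:E - (I * ln I)%:E)%E.

Definition Phi (R : realType) (n : nat) (f : 'rV[R]_n -> R) (x : 'rV[R]_n)
  : \bar R :=
  limf_esup (fun e : R => ((f x - f (((1 - e) / (1 + e)) *: x)) / e)%:E)
            (0 : R)^'+.

Definition QC (R : realType) (n : nat) (O : set 'rV[R]_n)
  (mu : probability (borelRn R n) R) (f : 'rV[R]_n -> R) : Prop :=
  (forall x, O x -> 0 <= f x) /\
  {within O, continuous f} /\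
  (forall x, O x -> f (- x) = f x) /\
  (forall l : R, convex_rV [set x | O x /\ f x < l]) /\
  exists (g : 'rV[R]_n -> R) (eps0 : R),
    (forall x, O x -> 0 <= g x) /\
    mu.-integrable O (fun x => (g x)%:E) /\
    0 < eps0 <= 1 /\
    (forall x (e : R), O x -> 0 < e < eps0 ->
       (f x - f (((1 - e) / (1 + e)) *: x)) / e <= g x).

Definition QC1 (R : realType) (n : nat) (O : set 'rV[R]_n)
  (mu : probability (borelRn R n) R) (f : 'rV[R]_n -> R) : Prop :=
  QC O mu f /\ mu.-integrable O (fun x => (f x)%:E).

(* Main.v *)
(* Let p be the gauge of K. The dilation K_e is {p < (1+e)/(1-e)}, which contains
   {p <= 1+2e}. Apply the entropy inequality to the ramp
   f = min(1, max(0, (p-1)/(2e))), a continuous substitute for the indicator of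
   the complement of K at scale e: Phi_f is at most (1+2e)/e, and vanishes off
   {1 < p <= 1+2e}, a subset of K_e \ K.
   With D = mu(K_e) - mu(K), the integral of f lies within D of 1 - mu(K) and the
   integral of f log f is at least -D. If D/e stayed below a constant
   smaller than the claimed bound, D would tend to 0 along with e, and continuity
   of x log x at 1 - mu(K) would give a contradiction. *)
Require Import Defs.
From HB Require Import structures.
From mathcomp Require Import all_boot all_order all_algebra.
From mathcomp Require Import all_classical all_reals all_analysis.
From mathcomp Require Import measurable_realfun.
From mathcomp Require Import ring lra.
Import Order.TTheory GRing.Theory Num.Theory.
Import numFieldNormedType.Exports.
Local Open Scope classical_set_scope.
Local Open Scope ring_scope.

(** * The Minkowski gauge of an open symmetric convex set *)

Section gauge.
Context {R : realType} {n : nat}.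
Implicit Types (K : set 'rV[R]_n) (x y : 'rV[R]_n).

Definition gauge K x : R := inf [set t | 0 < t /\ K (t^-1 *: x)].

Lemma open_scale_near K x (s : R) : open K -> K (s *: x) ->
  exists2 e, 0 < e & forall s', `|s' - s| < e -> K (s' *: x).
Proof.
move=> oK Ksx.
have : nbhs s ((fun u : R => u *: x) @^-1` K).
  by apply: (@scalel_continuous R 'rV[R]_n x s); exact: open_nbhs_nbhs.
move=> /nbhs_ballP[e /= e0 eK]; exists e => // s' s's; apply: eK.
by rewrite /ball/= distrC.
Qed.

Lemma sym_convex0 K : K !=set0 -> symmetric_set K -> convex_rV K -> K 0.
Proof.
move=> [x Kx] sK cK; have := cK _ _ 2^-1 Kx (sK _ Kx).
have -> : (1 - 2^-1) *: x + 2^-1 *: - x = 0 :> 'rV[R]_n.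
  by rewrite scalerN -scalerBl (_ : _ - _ - _ = 0) ?scale0r//; field.
by apply; lra.
Qed.

Lemma convex0_scale K x (s : R) : convex_rV K -> K 0 -> 0 <= s <= 1 -> K x ->
  K (s *: x).
Proof.
by move=> cK K0 s01 Kx; have := cK _ _ _ K0 Kx s01; rewrite scaler0 add0r.
Qed.

Lemma gauge_ge0 K x : 0 <= gauge K x.
Proof.
rewrite /gauge; set S := (X in inf X).
have [[t St]|S0] := pselect (S !=set0).
  by apply: lb_le_inf; [exists t|move=> u [/ltW]].
suff -> : S = set0 by rewrite inf0.
by rewrite -subset0 => t St; apply: S0; exists t.
Qed.

Section body.
Variable K : set 'rV[R]_n.
Hypotheses (K0 : K 0) (sK : symmetric_set K) (oK : open K) (cK : convex_rV K).
Local Notation p := (gauge K).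

(** An admissible [u < t] passes to [t] by shrinking towards [0], which lies in [K]; conversely,
    openness leaves room to enlarge [t^-1], so the infimum falls strictly below [t]. The later
    algebra of the gauge rests on this equivalence. *)
Lemma gauge_lt x (t : R) : 0 < t -> p x < t <-> K (t^-1 *: x).
Proof.
move=> t0; split=> [pt|Ktx].
- have [e e0 eK] : exists2 e, 0 < e & forall s : R, `|s - 0| < e -> K (s *: x).
    by apply: (open_scale_near K x 0) => //; rewrite scale0r.
  have [|u [u0 Ku] ut] := inf_lt _ pt.
    (* [inf_lt] asks for an admissible scale: the inverse of [2 / e] is [e / 2], within [e] of
       [0]. *)
    exists (2 / e); split; first by rewrite divr_gt0.
    apply: eK; rewrite subr0 invf_div ger0_norm ?divr_ge0 ?ltW//.
    by rewrite ltr_pdivrMr//; lra.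
  have -> : t^-1 *: x = (u / t) *: (u^-1 *: x).
    by rewrite scalerA; congr (_ *: _); field; rewrite !gt_eqF.
  apply: convex0_scale => //.
  by rewrite divr_ge0 ?(ltW t0) ?(ltW u0)//= ler_pdivrMr// mul1r ltW.
- have [e e0 eK] := open_scale_near _ _ _ oK Ktx.
  set s := t^-1 + e / 2.
  have tV0 : 0 < t^-1 by rewrite invr_gt0.
  have s0 : 0 < s by rewrite /s; lra.
  apply: (@le_lt_trans _ _ s^-1); last first.
    by rewrite -[ltRHS]invrK ltf_pV2 ?posrE// /s; lra.
  apply: ge_inf; first by exists 0 => u [/ltW].
  split; rewrite ?invr_gt0// invrK; apply: eK.
  by rewrite /s addrC addKr ger0_norm; lra.
Qed.

Lemma gauge_lt1 x : p x < 1 <-> K x.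
Proof. by rewrite gauge_lt// invr1 scale1r. Qed.

(** Comparing positive strict upper bounds lets [gauge_lt] prove inequalities between gauges without
    returning to the infimum. *)
Lemma le_from_ub (a b : R) : 0 <= b ->
  (forall t : R, 0 < t -> b < t -> a < t) -> a <= b.
Proof.
move=> b0 h; apply/ler_addgt0Pr => e e0; apply/ltW/h; last by rewrite ltrDl.
by rewrite ltr_wpDl.
Qed.

Lemma gauge0 : p 0 = 0.
Proof.
apply/eqP; rewrite eq_le gauge_ge0 andbT; apply: le_from_ub => // t t0 _.
by apply/gauge_lt => //; rewrite scaler0.
Qed.

Lemma gaugeN x : p (- x) = p x.
Proof.
apply/eqP; rewrite eq_le; apply/andP; split; apply: le_from_ub;
  rewrite ?gauge_ge0// => t t0; rewrite !gauge_lt// scalerN => /sK//.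
by rewrite opprK.
Qed.

Lemma gaugeZ x (s : R) : p (s *: x) = `|s| * p x.
Proof.
wlog s0 : s / 0 < s => [hw|].
  have [s0|s0|<-] := ltgtP 0 s; first exact: hw.
  - by rewrite -gaugeN -scaleNr -normrN; apply: hw; rewrite oppr_gt0.
  - by rewrite scale0r gauge0 normr0 mul0r.
rewrite gtr0_norm//.
have H t : 0 < t -> (p (s *: x) < t <-> s * p x < t).
  move=> t0; rewrite gauge_lt// [s * _]mulrC -ltr_pdivlMr// gauge_lt ?divr_gt0//.
  by rewrite scalerA invf_div [s / t]mulrC.
apply/eqP; rewrite eq_le; apply/andP; split; apply: le_from_ub.
- by rewrite mulr_ge0 ?gauge_ge0 ?ltW.
- by move=> t t0 /(H _ t0).
- exact: gauge_ge0.
- by move=> t t0 /(H _ t0).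
Qed.

Lemma gaugeD x y : p (x + y) <= p x + p y.
Proof.
apply/ler_addgt0Pr => e e0.
set a := p x + e / 2; set b := p y + e / 2.
have a0 : 0 < a by have := gauge_ge0 K x; rewrite /a; lra.
have b0 : 0 < b by have := gauge_ge0 K y; rewrite /b; lra.
have -> : p x + p y + e = a + b by rewrite /a /b; field.
have ab0 : 0 < a + b by rewrite addr_gt0.
apply/ltW/gauge_lt => //.
have Kx : K (a^-1 *: x) by apply/gauge_lt; rewrite // /a; lra.
have Ky : K (b^-1 *: y) by apply/gauge_lt; rewrite // /b; lra.
have -> : (a + b)^-1 *: (x + y) =
    (1 - b / (a + b)) *: (a^-1 *: x) + (b / (a + b)) *: (b^-1 *: y).
  rewrite !scalerA scalerDr; congr (_ *: _ + _ *: _);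
    field; rewrite !gt_eqF//=.
apply: cK => //.
by rewrite divr_ge0 ?(ltW ab0) ?(ltW b0)//= ler_pdivrMr// mul1r lerDr ltW.
Qed.

Lemma gaugeB x y : `|p x - p y| <= p (x - y).
Proof.
have h u v : p u - p v <= p (u - v).
  by rewrite lerBlDr -{1}(subrK v u) gaugeD.
by rewrite ler_norml h lerNl opprB -(gaugeN (x - y)) opprB h.
Qed.

Lemma gauge_continuous : continuous (p : 'rV[R]_n -> R).
Proof.
move=> x; apply/(@cvgrPdist_lt _ _ _ (nbhs x)) => e e0.
(* The neighbourhood [x - e K] consists of the [y] with [p (x - y) < e], and [gaugeB] turns this
   into closeness of the gauges. *)
have : nbhs x ((fun y => e^-1 *: (x - y)) @^-1` K).
  have cf : {for x, continuous (fun y => e^-1 *: (x - y))}.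
    apply: continuousZ; first exact: cst_continuous.
    by apply: continuousB => //; exact: cst_continuous.
  by apply: cf; apply: open_nbhs_nbhs; split => //; rewrite subrr scaler0.
apply: filterS => y /= Ky; apply: le_lt_trans (gaugeB _ _) _.
exact/gauge_lt.
Qed.

Lemma gauge_quasiconvex x y (t : R) : 0 <= t <= 1 ->
  p ((1 - t) *: x + t *: y) <= Num.max (p x) (p y).
Proof.
move=> t01; apply/ler_addgt0Pr => e e0; set s := _ + e.
have xs : p x < s by rewrite ltr_pwDr// le_max lexx.
have ys : p y < s by rewrite ltr_pwDr// le_max lexx orbT.
have s0 : 0 < s by apply: le_lt_trans xs; exact: gauge_ge0.
apply/ltW/gauge_lt => //; rewrite scalerDr !scalerA ![s^-1 * _]mulrC -!scalerA.
by apply: cK => //; exact/gauge_lt.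
Qed.

(** * Chords of [K], and the dilation as a sublevel set of the gauge *)

Let segment x y (t : R) := (1 - t) *: x + t *: y.

(** Write [q = p (y - x)]. The triangle inequality gives [(t2 - t1) q < 2] and [p x < 1 + t1 q]. If
    [t2 - t1 > 1 - e], then [t1 < e] and [(1 - e) q <= 2], whence [(1 - e) p x < 1 + e], against the
    assumption. *)
Lemma chord_length x y (e t1 t2 : R) : 0 < e < 1 -> (1 + e) / (1 - e) <= p x ->
  0 <= t1 -> t2 <= 1 -> K (segment x y t1) -> K (segment x y t2) ->
  t2 - t1 <= 1 - e.
Proof.
move=> e01 px t10 t21 /gauge_lt1 K1 /gauge_lt1 K2; rewrite leNgt; apply/negP.
have e1 : 0 < 1 - e by lra.
move: px; rewrite ler_pdivrMr// => px tt.
have q1 : (t2 - t1) * p (y - x) < 2.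
  have t12 : 0 <= t2 - t1 by lra.
  rewrite -[X in X * _](ger0_norm t12) -gaugeZ.
  have -> : (t2 - t1) *: (y - x) = segment x y t2 - segment x y t1.
    by apply/rowP => i; rewrite !mxE; ring.
  by apply: le_lt_trans (gaugeD _ _) _; rewrite gaugeN; lra.
have q2 : p x < 1 + t1 * p (y - x).
  rewrite -[X in X * _](ger0_norm t10) -gaugeZ.
  have {1}-> : x = segment x y t1 + - (t1 *: (y - x)).
    by apply/rowP => i; rewrite !mxE; ring.
  by apply: le_lt_trans (gaugeD _ _) _; rewrite gaugeN; lra.
have q0 := gauge_ge0 K (y - x).
move: (p (y - x)) (p x) q1 q2 q0 px {K1 K2} => q a q1 q2 q0 px.
have : (1 - e) * q <= 2 by nra.
have : t1 * q <= e * q by nra.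
by nra.
Qed.

Lemma segment_measurable x y : measurable (segment x y @^-1` K : set R).
Proof.
apply: open_measurable; apply: open_comp => // t _.
apply: (@continuousD R 'rV[R]_n R (fun t => (1 - t) *: x) (fun t => t *: y)).
  apply: continuousZ; last exact: cst_continuous.
  by apply: continuousB => //; exact: cst_continuous.
by apply: continuousZ => //; exact: cst_continuous.
Qed.

(** The integral is the time a segment from [x] spends in [K]. For large [p x] it is at most [1 - e]
    by [chord_length]; for [1 <= p x] below the threshold, the segment through the origin to the
    antipodal boundary point [- x / p x] stays in [K] long enough. *)
Lemma dil_setE (e : R) : 0 < e < 1 ->
  dil_set K e = [set x | p x < (1 + e) / (1 - e)].
Proof.
move=> e01; have e1 : 0 < 1 - e by lra.
have intE x y : (\int[@lebesgue_measure R]_(t in `[0%R, 1%R])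
    (\1_K ((1 - t) *: x + t *: y) : R)%:E =
    lebesgue_measure (`[0%R, 1%R] `&` (segment x y @^-1` K : set R)))%E.
  by rewrite setIC -integral_indic//; exact: segment_measurable.
have c1 : 1 < (1 + e) / (1 - e) by rewrite ltr_pdivlMr//; lra.
apply/seteqP; split=> x /=.
- move=> [/gauge_lt1 Kx|[y]]; first by rewrite (lt_trans Kx).
  rewrite intE ltNge => h; rewrite ltNge; apply: contra h => px.
  set T := _ `&` _.
  have [->|/set0P [t0 Tt0]] := eqVneq T set0.
    by rewrite measure0 lee_fin ltW.
  have lT : has_lbound T by exists 0 => t [/=]; rewrite in_itv/= => /andP[].
  (* Any two times in [T] differ by at most [1 - e], so the bound also holds from the infimum of
     [T]. *)
  have sub : T `<=` `[inf T, inf T + (1 - e)].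
    move=> t Tt; rewrite /= in_itv/= ge_inf//= -lerBlDr.
    apply: lb_le_inf; first by exists t0.
    move=> u [/= + Ku]; rewrite in_itv/= => /andP[u0 _].
    have [/= + Kt] := Tt; rewrite in_itv/= => /andP[_ t1].
    by rewrite lerBlDr addrC -lerBlDr; apply: (chord_length x y).
  have : (@lebesgue_measure R T <=
      lebesgue_measure (`[inf T, (inf T + (1 - e))%R]%classic : set R))%E.
    apply: le_measure => //; rewrite inE//.
    by apply: measurableI => //; exact: segment_measurable.
  move=> /le_trans; apply.
  by rewrite lebesgue_measure_itv/= lte_fin ltrDl e1 -EFinB addrAC subrr add0r.
- move=> pxc; have [/gauge_lt1 Kx|px] := ltP (p x) 1; [by left|right].
  have p0 : 0 < p x by lra.
  exists (- (p x)^-1 *: x); rewrite intE.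
  (* The gauge at time [t] of this segment is the absolute value of [p x - t (p x + 1)], which is
     below 1 exactly for [b < t < 1]. *)
  set b := (p x - 1) / (p x + 1).
  have b1 : b < 1 by rewrite ltr_pdivrMr; lra.
  have sub : `]b, 1[ `<=` `[0%R, 1%R] `&`
      (segment x (- (p x)^-1 *: x) @^-1` K : set R).
    move=> t /=; rewrite in_itv/= => /andP[bt t1].
    have b0 : 0 <= b by rewrite divr_ge0; lra.
    split; first by rewrite in_itv/=; lra.
    apply/gauge_lt1.
    have -> : segment x (- (p x)^-1 *: x) t = ((1 - t) - t / p x) *: x.
      by rewrite /segment scalerA -scalerDl mulrN.
    rewrite gaugeZ -[X in _ * X](gtr0_norm p0) -normrM mulrBl divfK ?gt_eqF//.
    by move: bt; rewrite /b ltr_pdivrMr ?ltr_norml; [nra|lra].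
  have : (@lebesgue_measure R `]b, 1%R[ <= lebesgue_measure (`[0%R, 1%R] `&`
      (segment x (- (p x)^-1 *: x) @^-1` K : set R)))%E.
    apply: le_measure => //; rewrite inE//.
    by apply: measurableI => //; exact: segment_measurable.
  apply: lt_le_trans.
  rewrite lebesgue_measure_itv/= lte_fin b1 -EFinB lte_fin.
  have -> : 1 - b = 2 / (p x + 1) by rewrite /b; field; lra.
  rewrite ltr_pdivlMr; last by lra.
  by move: pxc; rewrite ltr_pdivlMr//; lra.
Qed.

End body.
End gauge.

(** * Comparison of integrals of possibly nonmeasurable functions *)

Section integral_without_measurability.
Context {d} {T : measurableType d} {R : realType} (mu : {measure set T -> \bar R}).
Local Open Scope ereal_scope.

(* The library's integral is a supremum over simple functions below the
   integrand, so it is monotone without measurability; this spares proving that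
   [Phi f] is measurable. *)
Lemma le_integral_nonmeasurable (D : set T) (f g : T -> \bar R) :
  (forall x, D x -> 0 <= g x) -> (forall x, D x -> f x <= g x) ->
  \int[mu]_(x in D) f x <= \int[mu]_(x in D) g x.
Proof.
move=> g0 fg; rewrite integralE.
apply: (@le_trans _ _ (\int[mu]_(x in D) f^\+ x)).
  rewrite -[leRHS]adde0; apply: leeD => //.
  by rewrite oppe_le0 integral_ge0.
rewrite !ge0_integralE//; apply: ereal_sup_le => _ [h /= hf <-].
exists h => // x; apply: le_trans (hf x) _; rewrite !patchE; case: ifPn => //.
by rewrite inE => Dx; rewrite funeposE ge_max fg// g0.
Qed.

Lemma ge_integral_nonmeasurable (D : set T) (f g : T -> \bar R) :
  (forall x, D x -> 0 <= g x) -> (forall x, D x -> - g x <= f x) ->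
  - (\int[mu]_(x in D) g x) <= \int[mu]_(x in D) f x.
Proof.
move=> g0 fg; rewrite [leRHS]integralE -[leLHS]add0e; apply: leeD.
  exact: integral_ge0.
rewrite leeN2; apply: le_integral_nonmeasurable => // x Dx.
by rewrite funenegE ge_max g0// andbT leeNl fg.
Qed.

End integral_without_measurability.

(** * Upper and lower limits from eventual bounds *)

Section limits.
Context {R : realType} (F : set_system R).

Lemma limf_esup_le (f : R -> \bar R) (v : \bar R) :
  (\forall x \near F, f x <= v)%E -> (limf_esup f F <= v)%E.
Proof.
move=> Fv; rewrite limf_esupE.
apply: (@le_trans _ _ (ereal_sup (f @` [set x | (f x <= v)%E]))).
  by apply: ereal_inf_lbound; exists [set x | (f x <= v)%E].
by apply: ge_ereal_sup => _ [x /= fv <-].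
Qed.

Lemma limf_einf_ge (f : R -> \bar R) (v : \bar R) :
  (\forall x \near F, v <= f x)%E -> (v <= limf_einf f F)%E.
Proof.
move=> Fv; rewrite limf_einfE.
apply: (@le_trans _ _ (ereal_inf (f @` [set x | (v <= f x)%E]))).
  by apply: le_ereal_inf_tmp => _ [x /= fv <-].
by apply: ereal_sup_ubound; exists [set x | (v <= f x)%E].
Qed.

End limits.

(** * Borel measurability of open sets and continuous functions *)

Lemma open_borel_measurable (R : realType) (n : nat) (A : set 'rV[R]_n) :
  open A -> measurable (A : set (borelRn R n)).
Proof. by move=> oA; exact: sub_sigma_algebra. Qed.

Lemma continuous_borel_measurable (R : realType) (n : nat) (f : 'rV[R]_n -> R) :
  continuous f -> measurable_fun setT (f : borelRn R n -> R).
Proof.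
move=> /continuousP cf; apply: (measurability _ (RGenOpens.measurableE R)).
move=> _ [_ [a [b ->] <-]]; rewrite setTI; apply: open_borel_measurable.
exact/cf/interval_open.
Qed.

(** * The ramp test function: regularity, [Phi], and membership in [QC1] *)

Section ramp.
Context {R : realType} {n : nat}.
Variables (K : set 'rV[R]_n).
Hypotheses (K0 : K 0) (sK : symmetric_set K) (oK : open K) (cK : convex_rV K).
Local Notation p := (gauge K).

Definition ramp (d : R) (x : 'rV[R]_n) : R :=
  Num.min 1 (Num.max 0 ((p x - 1) / d)).

Variable d : R.
Hypothesis d0 : 0 < d.
Local Notation f := (ramp d).

Lemma ramp_ge0 x : 0 <= f x.
Proof. by rewrite /ramp le_min ler01 le_max lexx. Qed.

Lemma ramp_le1 x : f x <= 1.
Proof. by rewrite /ramp ge_min lexx. Qed.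

Lemma ramp_eq0 x : p x <= 1 -> f x = 0.
Proof.
move=> px; rewrite /ramp max_l ?min_r//.
by rewrite pmulr_lle0 ?invr_gt0// subr_le0.
Qed.

Lemma ramp_eq1 x : 1 + d <= p x -> f x = 1.
Proof.
move=> px; rewrite /ramp min_l// le_max; apply/orP; right.
by rewrite ler_pdivlMr// mul1r; lra.
Qed.

Lemma ramp_homo x y : p x <= p y -> f x <= f y.
Proof.
move=> xy; have xy' : (p x - 1) / d <= (p y - 1) / d.
  by rewrite ler_pM2r ?invr_gt0// lerB.
by rewrite /ramp le_min ge_min lexx/= ge_min ge_max !le_max lexx xy' !orbT.
Qed.

Lemma ramp_lip x y : p y <= p x -> f x - f y <= (p x - p y) / d.
Proof.
move=> yx; have -> : (p x - p y) / d = (p x - 1) / d - (p y - 1) / d by ring.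
have : (p y - 1) / d <= (p x - 1) / d by rewrite ler_pM2r ?invr_gt0// lerB.
rewrite /ramp; move: ((p x - 1) / d) ((p y - 1) / d) => u v uv.
by case: (leP 0 u) => ?; case: (leP 0 v) => ?; rewrite ?(min_r ler01);
  case: (leP 1 u) => ?; case: (leP 1 v) => ?; lra.
Qed.

Lemma rampN x : f (- x) = f x.
Proof. by rewrite /ramp gaugeN. Qed.

Lemma ramp_continuous : continuous (f : 'rV[R]_n -> R).
Proof.
have cp := gauge_continuous K K0 sK oK cK.
move=> x; apply: (@continuous_min R 'rV[R]_n (cst 1)
    (fun x => Num.max 0 ((p x - 1) / d)) x); first exact: cst_continuous.
apply: (@continuous_max R 'rV[R]_n (cst 0) (fun x => (p x - 1) / d) x).
  exact: cst_continuous.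
apply: (@continuousM R 'rV[R]_n (fun x => p x - 1) (cst d^-1)); last first.
  exact: cst_continuous.
apply: (@continuousB R R^o 'rV[R]_n p (cst 1)); last exact: cst_continuous.
exact: cp.
Qed.

Lemma ramp_quasiconvex x y (t : R) : 0 <= t <= 1 ->
  f ((1 - t) *: x + t *: y) <= Num.max (f x) (f y).
Proof.
move=> t01; have := gauge_quasiconvex K K0 oK cK x y t t01.
by rewrite !le_max => /orP[] /ramp_homo ->; rewrite ?orbT.
Qed.

Let r (s : R) := (1 - s) / (1 + s).

(** The estimate [1 - 2 s <= r s <= 1] controls the loss of gauge; it is the source of the factor 2
    in the quotient bounds. *)
Lemma gauge_contraction x (s : R) : 0 < s < 1 ->
  p (r s *: x) = (1 - s) / (1 + s) * p x /\
  p x - p (r s *: x) <= 2 * s * p x /\ p (r s *: x) <= p x.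
Proof.
move=> s01; have r0 : 0 < r s by rewrite divr_gt0; lra.
rewrite gaugeZ// (gtr0_norm r0); split => //.
have r1 : r s <= 1 by rewrite ler_pdivrMr; lra.
have r2 : 1 - 2 * s <= r s by rewrite ler_pdivlMr; nra.
have := gauge_ge0 K x; move: (r s) (p x) r0 r1 r2 => u v *.
by split; nra.
Qed.

Lemma ramp_quotient_le x (s : R) : 0 < s < 1 ->
  (f x - f (r s *: x)) / s <= 2 * p x / d.
Proof.
move=> s01; have [_ [h1 h2]] := gauge_contraction x s s01.
rewrite ler_pdivrMr; last lra.
apply: le_trans (ramp_lip _ _ h2) _.
by rewrite ler_pdivrMr// mulrAC divfK ?gt_eqF//; lra.
Qed.

(** Either [f x] is already the minimum 0, or the contracted point still carries the maximum 1. *)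
Lemma ramp_quotient_le0 x (s : R) : 0 < s < 1 ->
  p x <= 1 \/ 1 + d <= r s * p x -> (f x - f (r s *: x)) / s <= 0.
Proof.
move=> s01 px; rewrite pmulr_lle0 ?invr_gt0; last lra.
case: px => px; first by rewrite ramp_eq0// sub0r oppr_le0 ramp_ge0.
have [h0 _] := gauge_contraction x s s01.
by rewrite (ramp_eq1 (r s *: x)) ?h0// subr_le0 ramp_le1.
Qed.

(** On the shell, [p x <= 1 + d] is inserted into [ramp_quotient_le]. Inside, [f x] vanishes;
    strictly outside, small contractions do not reach the shell. *)
Lemma Phi_ramp_le x :
  (Phi f x <= (2 * (1 + d) / d * \1_[set x | (1 < p x <= 1 + d)%R] x)%:E)%E.
Proof.
have dp := d0; apply: limf_esup_le.
have near01 : \forall s \near (0 : R)^'+, 0 < s < 1.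
  near=> s; apply/andP; split; near: s; first exact: nbhs_right_gt.
  exact: nbhs_right_lt.
rewrite indicE; have [px|px] := boolP (x \in _).
  move: near01; apply: filterS => s s01; rewrite lee_fin mulr1.
  apply: le_trans (ramp_quotient_le x s s01) _.
  move: px; rewrite inE/= => /andP[px1 px2].
  by rewrite ler_pM2r ?invr_gt0//; lra.
rewrite mulr0; have [p1|p1] := leP (p x) 1.
  move: near01; apply: filterS => s s01; rewrite lee_fin.
  by apply: ramp_quotient_le0 => //; left.
have p2 : 1 + d < p x.
  by rewrite ltNge; apply: contra px => px; rewrite inE/= p1.
near=> s; rewrite lee_fin; have s01 : 0 < s < 1 by near: s.
apply: ramp_quotient_le0 => //; right.
rewrite /r mulrAC ler_pdivlMr; last lra.
have pd : 0 < p x + (1 + d) by lra.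
(* This threshold is the solution in [s] of [(1 - s) p x = (1 + d) (1 + s)]. *)
suff : s < (p x - (1 + d)) / (p x + (1 + d)) by rewrite ltr_pdivlMr//; lra.
by near: s; apply: nbhs_right_lt; rewrite divr_gt0; lra.
Unshelve. all: by end_near. Qed.

Lemma ramp_QC1 (O : set 'rV[R]_n) (mu : probability (borelRn R n) R) :
  sym_convex_domain O -> QC1 O mu f.
Proof.
have dp := d0; move=> [_ [oO [cO sO]]]; have mO := open_borel_measurable _ _ _ oO.
have muO : (mu O < +oo)%E by rewrite ltey_eq fin_num_measure.
split; last first.
  apply: measurable_bounded_integrable => //.
    apply: measurable_funTS.
    exact: (continuous_borel_measurable _ _ _ ramp_continuous).
  exists 1; split => // M M1 x _.
  by rewrite /= ger0_norm ?ramp_ge0// (le_trans (ramp_le1 _))// ltW.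
split; first by move=> x _; exact: ramp_ge0.
split; first exact: (continuous_subspaceT ramp_continuous).
split; first by move=> x _; exact: rampN.
split.
  move=> l x y t [Ox xl] [Oy yl] t01; split; first exact: cO.
  by apply: le_lt_trans (ramp_quasiconvex x y t t01) _; rewrite gt_max xl yl.
(* For [s < 1/3] the contraction factor is at least [1/2], so points with [p x > 2 (1 + d)] stay
   where the ramp is 1. For the others, [2 p x / d] is at most this constant. *)
exists (cst (4 * (1 + d) / d)), (3^-1); split.
  by move=> x _; rewrite divr_ge0; lra.
split; first exact: finite_measure_integrable_cst.
split; first lra.
move=> x s _ s3; have s01 : 0 < s < 1 by lra.
have c0 : 0 < 4 * (1 + d) / d by rewrite divr_gt0; lra.
have [px|px] := leP (p x) (2 * (1 + d)).
  apply: le_trans (ramp_quotient_le x s s01) _.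
  by rewrite ler_pM2r ?invr_gt0//; lra.
apply: le_trans (ltW c0); apply: ramp_quotient_le0 => //; right.
have : 2^-1 <= r s by rewrite ler_pdivlMr; lra.
by move: (r s) px => u px hu; nra.
Qed.

End ramp.

(** * The entropy inequality at a single scale *)

Lemma xlnx_geN1 (R : realType) (x : R) : 0 <= x <= 1 -> -1 <= x * ln x <= 0.
Proof.
move=> /andP[]; rewrite le_eqVlt => /predU1P[<- _|x0 x1].
  by rewrite mul0r; lra.
have lx : ln x <= 0 by rewrite ln_le0.
rewrite pmulr_rle0// lx andbT.
have xV0 : 0 < x^-1 by rewrite invr_gt0.
(* Multiplied by [x], this reads [x ln x >= x - 1], hence the bound [-1]. *)
have : ln (1 + (x^-1 - 1)) <= x^-1 - 1 by rewrite le_ln1Dx//; lra.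
rewrite addrC subrK lnV ?posrE// => lxV.
have : x * - ln x <= x * (x^-1 - 1) by rewrite ler_pM2l.
by rewrite mulrBr mulfV ?gt_eqF//; lra.
Qed.

Section one_dilation.
Context {R : realType} {n : nat}.
Variables (O K : set 'rV[R]_n) (mu : probability (borelRn R n) R) (kappa : R).
Hypotheses (domO : sym_convex_domain O) (muO : mu O = 1%E) (kappa0 : 0 < kappa).
Hypothesis ent : forall f : 'rV[R]_n -> R, QC1 O mu f ->
  (Ent O mu f <= (kappa^-1)%:E * \int[mu]_(x in O) Phi f x)%E.
Hypotheses (K0 : K 0) (sK : symmetric_set K) (oK : open K) (cK : convex_rV K).
Local Notation p := (gauge K).

Lemma dil_open (e : R) : 0 < e < 1 -> open (dil_set K e).
Proof.
move=> e01; rewrite dil_setE//.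
rewrite (_ : [set x | _] = p @^-1` [set` `]-oo, (1 + e) / (1 - e)[]); last first.
  by apply/seteqP; split => x /=; rewrite in_itv.
apply: open_comp => [x _|]; last exact: interval_open.
exact: (gauge_continuous K K0 sK oK cK).
Qed.

(** This collects what the limit argument needs at a fixed [e]; the witness [I] is the integral of
    the ramp of width [2 e]. *)
Lemma dil_ramp_entropy (e : R) : 0 < e < 1 ->
  let m := fine (mu K) in
  let D := fine (mu (dil_set K e)) - m in
  0 <= D /\ exists I : R,
    1 - m - D <= I <= 1 - m /\
    kappa * (- D - I * ln I) <= (1 + 2 * e) / e * D.
Proof.
move=> e01 m D; set Ke := dil_set K e; have [e0 e1] := andP e01.
have [_ [oO _]] := domO.
have mO : measurable (O : set (borelRn R n)) by exact: open_borel_measurable.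
have mK : measurable (K : set (borelRn R n)) by exact: open_borel_measurable.
have mKe : measurable (Ke : set (borelRn R n)).
  by apply: open_borel_measurable; exact: dil_open.
have KKe : K `<=` Ke by move=> x Kx; left.
have muK : mu K = m%:E by rewrite fineK// fin_num_measure.
have muKe : mu Ke = (m + D)%:E.
  by rewrite /D addrC subrK fineK// fin_num_measure.
have D0 : 0 <= D.
  by rewrite -(lerD2l m) addr0 -lee_fin -muK -muKe le_measure ?inE.
split => //.
pose d := 2 * e; have d0 : 0 < d by rewrite /d; lra.
pose f := ramp K d.
have f01 x : 0 <= f x <= 1 by rewrite ramp_ge0 ramp_le1.
have KeP x : Ke x = (p x < (1 + e) / (1 - e)) :> Prop by rewrite /Ke dil_setE.
have fK x : K x -> f x = 0.
  by move=> /(gauge_lt1 K K0 oK cK)/ltW; exact: ramp_eq0.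
(* Since [(1 + 2 e) (1 - e) = 1 + e - 2 e^2 < 1 + e], the width [d = 2 e] keeps the shell inside
   [Ke]. *)
have dKe x : p x <= 1 + d -> Ke x.
  move=> px; rewrite KeP; apply: le_lt_trans px _.
  by rewrite /d ltr_pdivlMr; nra.
have fKe x : ~ Ke x -> f x = 1.
  move=> nKe; apply: ramp_eq1 => //; rewrite leNgt; apply/negP => /ltW px.
  exact/nKe/dKe.
pose S := Ke `\` K.
have mS : measurable (S : set (borelRn R n)) by exact: measurableD.
have muS : (mu S <= D%:E)%E.
  have : mu Ke = (mu S + mu K)%E by rewrite {1}(measureDI mu mKe mK) setIidr.
  rewrite muK muKe -[mu S]fineK ?fin_num_measure// -EFinD => -[mD].
  by rewrite lee_fin; lra.
(* Used with [c = 1] for [f ln f] and with [c = (1 + 2 e) / e] for [Phi f]. *)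
have intS (c : R) : 0 <= c ->
    (\int[mu]_(x in O) (c * \1_S x)%:E <= (c * D)%:E)%E.
  move=> c0; under eq_integral do rewrite EFinM.
  rewrite ge0_integralZl//; last first.
    by apply/measurable_EFinP; exact: measurable_indic.
  rewrite integral_indic// EFinM lee_wpmul2l ?lee_fin//.
  exact: le_trans (measureIl _ _ _) muS.
set I := fine (\int[mu]_(x in O) (f x)%:E)%E; exists I.
(* The ramp lies between the indicators of the complements of [Ke] and [K], which sandwiches its
   integral. *)
have Iub : (\int[mu]_(x in O) (f x)%:E <= (1 - m)%:E)%E.
  apply: (@le_trans _ _ (\int[mu]_(x in O) (\1_(~` K) x)%:E)%E).
    apply: le_integral_nonmeasurable => x _; rewrite lee_fin// indicE in_setC.
    have [/set_mem/fK->|_] := boolP (x \in K); first by rewrite ler0n.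
    by case/andP: (f01 x).
  rewrite integral_indic//; last exact: measurableC.
  apply: le_trans (measureIl _ _ _) _ => //; first exact: measurableC.
  have : (mu (~` (K : set (borelRn R n))) <= 1 - mu K)%E.
    by rewrite probability_setC.
  by rewrite muK -EFinB.
have Ilb : ((1 - m - D)%:E <= \int[mu]_(x in O) (f x)%:E)%E.
  apply: (@le_trans _ _ (\int[mu]_(x in O) (\1_(~` Ke) x)%:E)%E).
    rewrite integral_indic//; last exact: measurableC.
    have : (mu O <= mu (O `\` Ke) + mu Ke)%E.
      by rewrite (measureDI mu mO mKe) leeD2l// measureIr.
    rewrite muO muKe setDE setIC -leeBlDr//; apply: le_trans.
    by rewrite -EFinB lee_fin; lra.
  apply: le_integral_nonmeasurable => x _; rewrite lee_fin.
    by case/andP: (f01 x).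
  rewrite indicE in_setC; have [_|/negP nKe] := boolP (x \in Ke).
    by case/andP: (f01 x).
  by rewrite fKe//; move=> h; apply: nKe; rewrite inE.
(* Finiteness ensures that the [fine] in [Ent] returns the actual integral. *)
have Ifin : (\int[mu]_(x in O) (f x)%:E)%E = I%:E.
  rewrite fineK// fin_real// (lt_le_trans _ Ilb) ?ltNyr//.
  by rewrite (le_lt_trans Iub) ?ltry.
have I01 : 1 - m - D <= I <= 1 - m by rewrite -!lee_fin -Ifin Ilb Iub.
split => //.
(* Off [S] the ramp is 0 or 1, so [f ln f] vanishes there; on [S] it is at least [-1]. *)
have flnf : ((- D)%:E <= \int[mu]_(x in O) (f x * ln (f x))%:E)%E.
  apply: (@le_trans _ _ (- \int[mu]_(x in O) (1 * \1_S x)%:E)%E).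
    by have := intS 1 ler01; rewrite mul1r EFinN leeN2.
  apply: ge_integral_nonmeasurable => x _; first by rewrite lee_fin mul1r.
  rewrite -EFinN lee_fin mul1r indicE.
  have [xS|xS] := boolP (x \in S).
    by have /andP[] := xlnx_geN1 R (f x) (f01 x).
  have [Kx|nKx] := pselect (K x); first by rewrite fK// mul0r oppr0.
  rewrite fKe ?ln1 ?mulr0 ?oppr0// => Kex.
  by move/negP: xS; apply; rewrite inE.
have intPhi : (\int[mu]_(x in O) Phi f x <= ((1 + 2 * e) / e * D)%:E)%E.
  have c0 : 0 <= (1 + 2 * e) / e by rewrite divr_ge0; lra.
  apply: le_trans (intS _ c0).
  apply: le_integral_nonmeasurable => x _; first by rewrite lee_fin mulr_ge0.
  apply: le_trans (Phi_ramp_le K K0 sK oK cK d d0 x) _.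
  have -> : 2 * (1 + d) / d = (1 + 2 * e) / e by rewrite /d; field; lra.
  rewrite lee_fin ler_wpM2l// !indicE ler_nat.
  have [|//] := boolP (x \in [set x | 1 < p x <= 1 + d]).
  rewrite inE => /= /andP[p1 p2]; suff : S x by move/mem_set ->.
  split; first exact: dKe.
  by move=> /(gauge_lt1 K K0 oK cK); rewrite ltNge ltW.
have := ent f (ramp_QC1 K K0 sK oK cK d d0 O mu domO).
rewrite /Ent Ifin /= => entf.
have : ((- D - I * ln I)%:E <= (kappa^-1 * ((1 + 2 * e) / e * D))%:E)%E.
  apply: (@le_trans _ _ (\int[mu]_(x in O) (f x * ln (f x))%:E
      - (I * ln I)%:E)%E); first by rewrite EFinB leeD2r.
  apply: le_trans entf _.
  by rewrite EFinM lee_wpmul2l// lee_fin invr_ge0 ltW.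
by rewrite lee_fin -ler_pdivlMl.
Qed.

End one_dilation.

(** * Continuity of [x ln x] and passage to the limit *)

Lemma xlnx_near (R : realType) (a k c : R) : 0 <= a -> c < - k * a * ln a ->
  0 < c -> exists2 d : R, 0 < d & forall I, `|I - a| < d -> c < - k * I * ln I.
Proof.
(* For [a = 0] the assumptions read [c < 0] and [0 < c], so continuity of [ln] is only needed at
   positive [a]. *)
rewrite le_eqVlt => /predU1P[<-|a0 cB c0]; first by rewrite mulr0 mul0r; lra.
have : nbhs a ((fun I => - k * I * ln I) @^-1` `]c, +oo[%classic).
  have ca : {for a, continuous (fun I => - k * I * ln I)}.
    apply: continuousM; last exact: continuous_ln.
    by apply: continuousM; [exact: cst_continuous|].
  apply: ca; apply: open_nbhs_nbhs; split; first exact: interval_open.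
  by rewrite /= in_itv/= andbT.
move=> /nbhs_ballP[d /= d0 h]; exists d => // I Ia.
have := h I; rewrite /ball/= distrC => /(_ Ia); by rewrite in_itv/= andbT.
Qed.

Theorem theoremt (R : realType) (n : nat) (O : set 'rV[R]_n)
  (mu : probability (borelRn R n) R) (kappa : R) :
  sym_convex_domain O ->
  mu O = 1%E ->
  (\int[mu]_(x in O) (eucl_norm x)%:E < +oo)%E ->
  0 < kappa ->
  (forall f : 'rV[R]_n -> R, QC1 O mu f ->
     (Ent O mu f <= (kappa^-1)%:E * \int[mu]_(x in O) Phi f x)%E) ->
  dilation_ineq O mu kappa.
Proof.
move=> domO muO _ kappa0 ent K [Kne [sK [oK [cK _]]]].
have K0 : K 0 by exact: sym_convex0.
set m := fine (mu K); set B := - kappa * (1 - m) * ln (1 - m).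
have mK : measurable (K : set (borelRn R n)) by exact: open_borel_measurable.
have m1 : 0 <= 1 - m.
  by rewrite subr_ge0 -lee_fin fineK ?fin_num_measure// probability_le1.
apply/lee_subgt0Pr => h h0; rewrite -EFinB; set c := B - h.
apply: limf_einf_ge.
have step (e : R) : 0 < e < 1 ->
    c <= (fine (mu (dil_set K e)) - m) / e ->
    (c%:E <= (mu (dil_set K e) - mu K) * (e^-1)%:E)%E.
  move=> e01 ce.
  have mKe : measurable (dil_set K e : set (borelRn R n)).
    by apply: open_borel_measurable; exact: dil_open.
  rewrite -[mu (dil_set K e)]fineK ?fin_num_measure//.
  by rewrite -[mu K]fineK ?fin_num_measure// -EFinB -EFinM lee_fin.
have dil := dil_ramp_entropy O K mu kappa domO muO kappa0 ent K0 sK oK cK.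
(* A nonpositive [c] is covered by [D >= 0], that is, by monotonicity of the measure. *)
have [c0|c0] := leP c 0.
  near=> e; have e01 : 0 < e < 1.
    apply/andP; split; near: e; first exact: nbhs_right_gt.
    exact: nbhs_right_lt.
  apply: step => //; apply: le_trans c0 _.
  by have [D0 _] := dil e e01; rewrite divr_ge0//; case/andP: e01 => /ltW.
(* The slack [h] is split: one half pays for replacing [1 - m] by [I], the other absorbs the terms
   of order [e]. *)
have [||d d0 near_d] := xlnx_near R (1 - m) kappa (c + h / 2) m1.
- by rewrite -/B /c; lra.
- lra.
near=> e; have e01 : 0 < e < 1.
  apply/andP; split; near: e; first exact: nbhs_right_gt.
  exact: nbhs_right_lt.
apply: step => //; have [D0 [I [I01]]] := dil e e01.
move: I01 D0; rewrite -/m; set D := fine _ - m => I01 D0 hI.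
have [e0 _] := andP e01.
rewrite leNgt; apply/negP; rewrite ltr_pdivrMr// => De.
have ed : e * c < d.
  by rewrite -ltr_pdivlMr//; near: e; apply: nbhs_right_lt; rewrite divr_gt0.
have eh : e * (c * (2 + kappa)) < h / 2.
  rewrite -ltr_pdivlMr ?mulr_gt0//; last lra.
  by near: e; apply: nbhs_right_lt; rewrite !divr_gt0// mulr_gt0//; lra.
have Xlb : c + h / 2 < - kappa * I * ln I.
  by apply: near_d; rewrite ltr_norml; lra.
have Dub : (1 + 2 * e) / e * D <= (1 + 2 * e) * c.
  rewrite -mulrA ler_pM2l; last lra.
  by rewrite ler_pdivrMl//; lra.
have kDub : kappa * D <= kappa * (c * e) by rewrite ler_pM2l// ltW.
(* With [D < c e], the entropy bound gives [- kappa I ln I <= c + e c (2 + kappa) < c + h / 2],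
   contradicting [Xlb]. *)
by move: Xlb Dub kDub hI eh; move: (c) (ln I) (D) => u v w; clear; lra.
Unshelve. all: by end_near. Qed.
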